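(* Let $k\ge1$ and let $\alpha_1,\beta_1,\beta_2\in\mathbb{R}$. If $\alpha_1^2+\beta_1\beta_2=\frac14$, then the projection $P_h^\star$ (associated with the parameters $\alpha_1,\beta_1,\beta_2$) is a local projection.
   Context: Mesh: $I=[a,b]$, $a=x_{1/2}<x_{3/2}<\dots<x_{N+1/2}=b$, $I_j=(x_{j-1/2},x_{j+1/2})$. $V_h^k$ is the space of functions on $I$ whose restriction to each $I_j$ is a polynomial of degree at most $k$. At an interface, $v^\pm$ denote the limits from the right ($+$) and left ($-$) cells, with periodic identification of $x_{1/2}$ and $x_{N+1/2}$; $[v]=v^+-v^-$, $\{v\}=\frac12(v^++v^-)$; the same notation is used for the piecewise derivative $v_x$. Projection $P_h^\star$: for a periodic function $u\in W^{1,\infty}(I)$ (such that the interface values of $u$ and $u_x$ are meaningful), $P_h^\star u\in V_h^k$ is the function $w\in V_h^k$ determined by requiring, for all $j=1,\dots,N$, (i) $\int_{I_j}w\,v_h\,dx=\int_{I_j}u\,v_h\,dx$ for all $v_h\in P^{k-2}(I_j)$ (this condition is void if $k=1$); (ii) $\{w\}-\alpha_1[w]+\beta_2[w_x]=u$ at $x_{j+1/2}$; (iii) $\{w_x\}+\alpha_1[w_x]+\beta_1[w]=u_x$ at $x_{j+1/2}$. ''Local projection'' means that $P_h^\star$ can be defined (solved for) element-wise: the global system (i)-(iii) over all $j$ is equivalent to a collection of linear systems, one for each cell $I_j$, where the system for $I_j$ involves only the restriction $w|_{I_j}$ (including its traces $w^+,w_x^+$ at $x_{j-1/2}$ and $w^-,w_x^-$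 at $x_{j+1/2}$) and the data of $u$ on the closure of $I_j$. *)

(* Defs.v *)
From HB Require Import structures.
From mathcomp Require Import all_boot all_order all_algebra.
From mathcomp Require Import all_classical all_reals all_analysis.

Set Implicit Arguments.
Unset Strict Implicit.
Unset Printing Implicit Defensive.

Import Order.TTheory GRing.Theory Num.Theory.
Import numFieldNormedType.Exports.

Local Open Scope classical_set_scope.
Local Open Scope ring_scope.

(* [x i] stands for $x_{i+1/2}$; only the values at [i <= N] are relevant. *)
Definition is_mesh (R : realType) (a b : R) (N : nat) (x : nat -> R) : Prop :=
  [/\ x 0%N = a, x N = b & forall i, (i < N)%N -> x i < x i.+1].

(* With 0-based indices, cell [j] is $I_{j+1}$. *)
Definition cell (R : realType) (x : nat -> R) (j : nat) : set R :=
  `]x j, x j.+1[.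
Definition closed_cell (R : realType) (x : nat -> R) (j : nat) : set R :=
  `[x j, x j.+1].

(* $V_h^k$.  The elements are total functions on R, but their values at the
   nodes and outside the mesh are never used. *)
Definition Vh (R : realType) (N : nat) (x : nat -> R) (k : nat) (w : R -> R) :
    Prop :=
  forall j : 'I_N, exists2 p : {poly R},
    (size p <= k.+1)%N & forall t, cell x j t -> w t = p.[t].

(* Traces at the right end node $x_{j+1}$ of cell [j].  The cell to the right
   of it is [ordS j], the cyclic successor of [j]: for the last cell this is
   cell 0, so the trace is taken at [x 0] (periodic identification). *)
Definition trace_minus (R : realType) (N : nat) (x : nat -> R) (v : R -> R)
    (j : 'I_N) : R := lim (v t @[t --> (x j.+1)^'-]).
Definition trace_plus (R : realType) (N : nat) (x : nat -> R) (v : R -> R)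
    (j : 'I_N) : R := lim (v t @[t --> (x (ordS j))^'+]).

Definition jump (R : realType) (N : nat) (x : nat -> R) (v : R -> R)
    (j : 'I_N) : R := trace_plus x v j - trace_minus x v j.
Definition average (R : realType) (N : nat) (x : nat -> R) (v : R -> R)
    (j : 'I_N) : R := 2^-1 * (trace_plus x v j + trace_minus x v j).

Definition test_function (R : realType) (a b : R) (phi : R -> R) : Prop :=
  (forall n t, derivable (phi^`(n))%classic t 1) /\
  closure [set t | phi t != 0] `<=` `]a, b[.

Definition weak_derivative (R : realType) (a b : R) (u g : R -> R) : Prop :=
  forall phi, test_function a b phi ->
    Rintegral lebesgue_measure `]a, b[ (fun t => u t * (phi^`())%classic t) =
    - Rintegral lebesgue_measure `]a, b[ (fun t => g t * phi t).

Definition Linfty (R : realType) (a b : R) (f : R -> R) : Prop :=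
  f \_ `]a, b[ \in Lfun (@lebesgue_measure R) +oo%E.

Definition W1infty (R : realType) (a b : R) (u : R -> R) : Prop :=
  Linfty a b u /\ exists2 g, Linfty a b g & weak_derivative a b u g.

(* The periodic functions of $W^{1,\infty}(I)$ to which the projection applies.
   [u] is the continuous representative of its class, so that its interface
   values make sense; the interface values of $u_x$ make sense by
   differentiability at the nodes. *)
Definition admissible (R : realType) (a b : R) (N : nat) (x : nat -> R)
    (u : R -> R) : Prop :=
  [/\ periodic u (b - a), continuous u, W1infty a b u &
      forall i, (i <= N)%N -> derivable u (x i) 1].

(* Conditions (i)-(iii) defining $w = P_h^\star u$ in $V_h^k$.  Degree at most
   $k - 2$ reads [size v <= k.-1]; for $k = 1$ this leaves only $v = 0$, so
   that (i) is void. *)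
Definition is_Phstar (R : realType) (N : nat) (x : nat -> R) (k : nat)
    (alpha1 beta1 beta2 : R) (u w : R -> R) : Prop :=
  Vh N x k w /\
  forall j : 'I_N,
  [/\ forall v : {poly R}, (size v <= k.-1)%N ->
        Rintegral lebesgue_measure (cell x j) (fun t => w t * v.[t]) =
        Rintegral lebesgue_measure (cell x j) (fun t => u t * v.[t]),
      average x w j - alpha1 * jump x w j + beta2 * jump x (w^`())%classic j =
        u (x j.+1) &
      average x (w^`())%classic j + alpha1 * jump x (w^`())%classic j
        + beta1 * jump x w j =
        (u^`())%classic (x j.+1)].

(* The system (i)-(iii) is equivalent to a family of linear systems
   [A j w = F j u], one for each cell, where [A j] is linear in [w] and depends
   only on the restriction of [w] to the cell, and [F j u] depends only on [u]
   on the closure of the cell.  (One-sided differentiation at the end nodes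
   recovers $u_x$ there from this restriction.)  [A] and [F] are chosen before
   [u] and [w]. *)
Definition local_projection (R : realType) (a b : R) (N : nat) (x : nat -> R)
    (k : nat) (alpha1 beta1 beta2 : R) : Prop :=
  exists (m : 'I_N -> nat)
         (A F : forall j : 'I_N, (R -> R) -> 'cV[R]_(m j)),
  [/\ forall (j : 'I_N) (c : R) v w, Vh N x k v -> Vh N x k w ->
        A j (fun t => c * v t + w t) = c *: A j v + A j w,
      forall (j : 'I_N) v w, Vh N x k v -> Vh N x k w ->
        (forall t, cell x j t -> v t = w t) -> A j v = A j w,
      forall (j : 'I_N) u u', admissible a b N x u -> admissible a b N x u' ->
        (forall t, closed_cell x j t -> u t = u' t) -> F j u = F j u' &
      forall u w, admissible a b N x u -> Vh N x k w ->
        (is_Phstar N x k alpha1 beta1 beta2 u w <->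
         forall j, A j w = F j u)].

(* Main.v *)
(* At each interface, (ii)-(iii) read [P W^+ + (1 - P) W^- = U], where [W^+],
   [W^-] and [U] are the columns of values and derivatives and
   [P = [[1/2 - alpha1, beta2], [beta1, 1/2 + alpha1]]].  As [P] has trace 1 and
   determinant [1/4 - alpha1^2 - beta1 beta2 = 0], it is idempotent, so the
   equation decouples into [P W^+ = P U] and [(1 - P) W^- = (1 - P) U], each of
   which involves a single cell. *)
Require Import Defs.
From mathcomp Require Import all_boot all_order all_algebra.
From mathcomp Require Import all_classical all_reals all_analysis.
From mathcomp Require Import ring.

Set Implicit Arguments.
Unset Strict Implicit.
Unset Printing Implicit Defensive.

Import Order.TTheory GRing.Theory Num.Theory.
Import numFieldNormedType.Exports.
Local Open Scope ring_scope.
Local Open Scope classical_set_scope.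

(** * One-sided limits and derivatives at the nodes *)

Lemma lim_at_left_eq (R : realType) (f g : R -> R) (y z : R) :
  y < z -> {for z, continuous g} -> (forall t, y < t < z -> f t = g t) ->
  lim (f t @[t --> z^'-]) = g z.
Proof.
move=> yz gz fg; apply: cvg_lim => //.
apply: cvg_trans (cvg_at_left_filter gz); apply: near_eq_cvg.
near=> t; rewrite fg//; apply/andP; split; near: t.
- exact: nbhs_left_gt.
- exact: nbhs_left_lt.
Unshelve. all: by end_near. Qed.

Lemma lim_at_right_eq (R : realType) (f g : R -> R) (y z : R) :
  y < z -> {for y, continuous g} -> (forall t, y < t < z -> f t = g t) ->
  lim (f t @[t --> y^'+]) = g y.
Proof.
move=> yz gy fg; apply: cvg_lim => //.
apply: cvg_trans (cvg_at_right_filter gy); apply: near_eq_cvg.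
near=> t; rewrite fg//; apply/andP; split; near: t.
- exact: nbhs_right_gt.
- exact: nbhs_right_lt.
Unshelve. all: by end_near. Qed.

Lemma derive1_eq_itv (R : realType) (f g : R -> R) (y z t : R) :
  (forall t, y < t < z -> f t = g t) -> y < t < z ->
  (f^`())%classic t = (g^`())%classic t.
Proof.
move=> fg tyz; rewrite !derive1E; apply: near_eq_derive.
have : \forall s \near t, y < s < z.
  by have := near_in_itvoo (_ : t \in `]y, z[%R); rewrite in_itv/= => /(_ tyz).
by apply: filterS => s /fg.
Qed.

(* For a function derivable at the node these are its derivative, but they read
   the function on one side of the node only. *)
Definition left_derivative (R : realType) (u : R -> R) (y : R) : R :=
  lim (h^-1 *: (u (h + y) - u y) @[h --> 0^'-]).
Definition right_derivative (R : realType) (u : R -> R) (y : R) : R :=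
  lim (h^-1 *: (u (h + y) - u y) @[h --> 0^'+]).

Lemma is_cvg_derive1 (R : realType) (u : R -> R) (y : R) : derivable u y 1 ->
  cvg (h^-1 *: (u (h + y) - u y) @[h --> 0^']).
Proof.
rewrite /derivable; under eq_fun do rewrite /= [_%:A]mulr1.
by [].
Qed.

Lemma left_derivativeE (R : realType) (u : R -> R) (y : R) :
  derivable u y 1 -> left_derivative u y = (u^`())%classic y.
Proof. by move=> /is_cvg_derive1 /cvg_at_leftE. Qed.

Lemma right_derivativeE (R : realType) (u : R -> R) (y : R) :
  derivable u y 1 -> right_derivative u y = (u^`())%classic y.
Proof. by move=> /is_cvg_derive1 /cvg_at_rightE. Qed.

Lemma eq_left_derivative (R : realType) (u v : R -> R) (y z : R) : y < z ->
  (forall t, y <= t <= z -> u t = v t) ->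
  left_derivative u z = left_derivative v z.
Proof.
(* Convergence is not assumed here, so the two image filters themselves are shown equal, by one
   inclusion in each direction. *)
move=> yz uv; congr lim; apply/seteqP; split; apply: near_eq_cvg; near=> h;
  (rewrite !uv ?lexx ?(ltW yz)//; apply/andP; split;
   [rewrite -lerBlDr; near: h; apply: nbhs_left_ge; rewrite subr_lt0//
   |rewrite gerDr]); near: h; exact: nbhs_left_le.
Unshelve. all: by end_near. Qed.

Lemma eq_right_derivative (R : realType) (u v : R -> R) (y z : R) : y < z ->
  (forall t, y <= t <= z -> u t = v t) ->
  right_derivative u y = right_derivative v y.
Proof.
move=> yz uv; congr lim; apply/seteqP; split; apply: near_eq_cvg; near=> h;
  (rewrite !uv ?lexx ?(ltW yz)//; apply/andP; split;
   [rewrite lerDr; near: h; exact: nbhs_right_ge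
   |rewrite -lerBrDr; near: h; apply: nbhs_right_le; rewrite subr_gt0//]).
Unshelve. all: by end_near. Qed.

Lemma derive1_periodic (R : realType) (u : R -> R) (T : R) :
  periodic u T -> periodic (u^`())%classic T.
Proof.
move=> uT y; rewrite /derive1; under eq_fun do rewrite addrA !uT.
by [].
Qed.

(** * Integrals against polynomials *)

Lemma continuous_integrable_itv (R : realType) (f : R -> R) (y z : R) :
  continuous f -> (@lebesgue_measure R).-integrable `]y, z[ (EFin \o f).
Proof.
move=> cf; apply: (@integrableS _ _ _ (@lebesgue_measure R) `[y, z]%classic)
  => //.
  exact: subset_itv_oo_cc.
apply: continuous_compact_integrable; first exact: segment_compact.
exact: continuous_subspaceT.
Qed.

Lemma Rintegral_horner (R : realType) (f : R -> R) (y z : R) (p : {poly R})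
    (n : nat) : continuous f -> (size p <= n)%N ->
  Rintegral lebesgue_measure `]y, z[ (fun t => f t * p.[t]) =
  \sum_(i < n)
    p`_i * Rintegral lebesgue_measure `]y, z[ (fun t => f t * t ^+ i).
Proof.
move=> cf; elim: n p => [|n IH] p.
  rewrite leqn0 size_poly_eq0 => /eqP->; rewrite big_ord0.
  under eq_Rintegral do rewrite horner0 mulr0.
  by rewrite /Rintegral integral0.
move=> pn.
have cfX m : continuous (fun t => f t * t ^+ m).
  by move=> t; apply: cvgM; [exact: cf|exact: exprn_continuous].
rewrite big_ord_recr/= -RintegralZl//; last exact: continuous_integrable_itv.
(* The induction hypothesis folds the lower terms back into one integral, that of the truncation
   [take_poly n p]. Additivity is then applied to just two integrands. *)
have -> : \sum_(i < n) p`_i *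
    Rintegral lebesgue_measure `]y, z[ (fun t => f t * t ^+ i) =
    Rintegral lebesgue_measure `]y, z[ (fun t => f t * (take_poly n p).[t]).
  rewrite (IH _ (size_take_poly _ _)); apply: eq_bigr => i _.
  by rewrite coef_take_poly ltn_ord.
rewrite -RintegralD//; [|apply: continuous_integrable_itv => t|].
  apply: eq_Rintegral => t _; rewrite (horner_coef_wide _ pn).
  rewrite (horner_coef_wide _ (size_take_poly _ _)) big_ord_recr/= mulrDr.
  congr (_ * _ + _); last by ring.
  by apply: eq_bigr => i _; rewrite coef_take_poly ltn_ord.
  by apply: cvgM; [exact: cf|exact: continuous_horner].
apply: (@continuous_integrable_itv _ (fun t => p`_n * (f t * t ^+ n))) => t.
by apply: cvgM; [exact: cvg_cst|exact: cfX].
Qed.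

(** * Interface equations and cell systems *)

Definition pair_col (R : realType) (y z : R) : 'cV[R]_2 :=
  \col_i (if i == 0 then y else z).

Definition flux_mx (R : realType) (alpha1 beta1 beta2 : R) : 'M[R]_2 :=
  \matrix_(i, j) if i == 0 then if j == 0 then 2^-1 - alpha1 else beta2
                 else if j == 0 then beta1 else 2^-1 + alpha1.

Lemma cV2P (R : realType) (u v : 'cV[R]_2) :
  u = v <-> u 0 0 = v 0 0 /\ u 1 0 = v 1 0.
Proof.
split=> [->//|[uv0 uv1]]; apply/matrixP => i j; rewrite [j]ord1.
by have [->|->] : i = 0 \/ i = 1; first (case: i => [[|[|//]] lti];
  [left|right]; exact/val_inj).
Qed.

Lemma flux_mx_pair_col (R : realType) (alpha1 beta1 beta2 y z : R) :
  flux_mx alpha1 beta1 beta2 *m pair_col y z =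
  pair_col ((2^-1 - alpha1) * y + beta2 * z) (beta1 * y + (2^-1 + alpha1) * z).
Proof.
by apply/cV2P; rewrite !mxE !big_ord_recl !big_ord0 !mxE/= !addr0.
Qed.

Lemma flux_mx_idem (R : realType) (alpha1 beta1 beta2 : R) :
  alpha1 ^+ 2 + beta1 * beta2 = 4^-1 ->
  flux_mx alpha1 beta1 beta2 *m flux_mx alpha1 beta1 beta2 =
  flux_mx alpha1 beta1 beta2.
Proof.
move=> ab; have {}ab : beta1 * beta2 = 4^-1 - alpha1 ^+ 2.
  by rewrite -ab addrC addKr.
apply/matrixP => i j; rewrite !mxE !big_ord_recl big_ord0 !mxE/=.
have ab' : beta2 * beta1 = 4^-1 - alpha1 ^+ 2 by rewrite mulrC.
(* The off-diagonal entries come from the trace being 1, the diagonal ones from the value of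
   [beta1 * beta2], which occurs in both orders. *)
by case: (i == 0); case: (j == 0); rewrite ?ab ?ab'; field.
Qed.

Lemma pair_col_linear (R : realType) (c y z y' z' : R) :
  pair_col (c * y + y') (c * z + z') = c *: pair_col y z + pair_col y' z'.
Proof. by apply/matrixP => i j; rewrite !mxE; case: ifP. Qed.

(** [P] and [1 - P] are complementary projections: multiplying the equation by either one kills the
    other term, and adding the two resulting equations gives it back. *)
Lemma idem_split_eq (R : realType) (n m : nat) (P : 'M[R]_n)
    (u v w : 'M[R]_(n, m)) :
  P *m P = P ->
  P *m u + (1%:M - P) *m v = w <->
  P *m u = P *m w /\ (1%:M - P) *m v = (1%:M - P) *m w.
Proof.
move=> PP; have PQ : P *m (1%:M - P) = 0 by rewrite mulmxBr mulmx1 PP subrr.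
have QP : (1%:M - P) *m P = 0 by rewrite mulmxBl mul1mx PP subrr.
have QQ : (1%:M - P) *m (1%:M - P) = 1%:M - P.
  by rewrite {1}mulmxBl mul1mx PQ subr0.
split=> [<-|[-> ->]]; last by rewrite -mulmxDl addrC subrK mul1mx.
by rewrite !mulmxDr !mulmxA PP PQ QP QQ !mul0mx addr0 add0r.
Qed.

(** Collect (ii) and (iii) by side: the right traces get the entries of [P], and the left traces get
    [1/2 + alpha1], [- beta2], [- beta1], [1/2 - alpha1], the entries of [1 - P]. *)
Lemma interface_eqP (R : realType) (alpha1 beta1 beta2 wl wr dl dr u du : R) :
  let P := flux_mx alpha1 beta1 beta2 in
  P *m pair_col wr dr + (1%:M - P) *m pair_col wl dl = pair_col u du <->
  2^-1 * (wr + wl) - alpha1 * (wr - wl) + beta2 * (dr - dl) = u /\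
  2^-1 * (dr + dl) + alpha1 * (dr - dl) + beta1 * (wr - wl) = du.
Proof.
move=> P; rewrite mulmxBl mul1mx !flux_mx_pair_col.
rewrite cV2P !mxE/=.
by split=> -[<- <-]; split; field.
Qed.

(** One shape serves both sides of the equation, with [f] either the unknown or the data. The cell
    lies to the right of its left end node, whence [P] there, and to the left of its right end node,
    whence [1 - P]. Testing against the [k - 1] monomials of degree at most [k - 2] expresses
    (i). *)
Definition cell_system (R : realType) (x : nat -> R) (j k : nat) (P : 'M[R]_2)
    (f : R -> R) (fl dl fr dr : R) : 'cV[R]_(k.-1 + (2 + 2)) :=
  col_mx (\col_i Rintegral lebesgue_measure (cell x j) (fun t => f t * t ^+ i))
    (col_mx (P *m pair_col fl dl) ((1%:M - P) *m pair_col fr dr)).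

Lemma cell_system_eqP (R : realType) (x : nat -> R) (j k : nat) (P : 'M[R]_2)
    (f g : R -> R) (fl dfl fr dfr gl dgl gr dgr : R) :
  cell_system x j k P f fl dfl fr dfr = cell_system x j k P g gl dgl gr dgr <->
  [/\ forall i : 'I_k.-1,
        Rintegral lebesgue_measure (cell x j) (fun t => f t * t ^+ i) =
        Rintegral lebesgue_measure (cell x j) (fun t => g t * t ^+ i),
      P *m pair_col fl dfl = P *m pair_col gl dgl &
      (1%:M - P) *m pair_col fr dfr = (1%:M - P) *m pair_col gr dgr].
Proof.
split=> [/eq_col_mx[/matrixP fg /eq_col_mx[-> ->]]|[fg el er]].
  by split=> // i; have := fg i 0; rewrite !mxE.
rewrite /cell_system el er; congr col_mx.
by apply/matrixP => i ?; rewrite !mxE.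
Qed.

Definition cell_lhs (R : realType) (x : nat -> R) (j k : nat) (P : 'M[R]_2)
    (w : R -> R) :=
  cell_system x j k P w
    (lim (w t @[t --> (x j)^'+])) (lim ((w^`())%classic t @[t --> (x j)^'+]))
    (lim (w t @[t --> (x j.+1)^'-]))
    (lim ((w^`())%classic t @[t --> (x j.+1)^'-])).

Definition cell_rhs (R : realType) (x : nat -> R) (j k : nat) (P : 'M[R]_2)
    (u : R -> R) :=
  cell_system x j k P u (u (x j)) (right_derivative u (x j))
    (u (x j.+1)) (left_derivative u (x j.+1)).

(** The open cell determines the traces of [w] and of its derivative, so they are values of [p] and
    of its formal derivative. Linearity and locality of the left-hand side thus become statements
    about polynomials. *)
Lemma cell_lhs_poly (R : realType) (x : nat -> R) (j k : nat) (P : 'M[R]_2)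
    (w : R -> R) (p : {poly R}) : x j < x j.+1 ->
  (forall t, cell x j t -> w t = p.[t]) ->
  cell_lhs x j k P w =
  cell_system x j k P (horner p)
    p.[x j] (p^`()).[x j] p.[x j.+1] (p^`()).[x j.+1].
Proof.
move=> xj wp.
have wp' t : x j < t < x j.+1 -> w t = p.[t].
  by move=> ?; apply: wp; rewrite /cell/= in_itv.
have dwp t : x j < t < x j.+1 -> (w^`())%classic t = (p^`()).[t].
  by move=> tj; rewrite (derive1_eq_itv wp' tj) derivE.
have cp (q : {poly R}) y : {for y, continuous (horner q)}
  by exact: continuous_horner.
rewrite /cell_lhs (lim_at_left_eq xj (@cp p _) wp').
rewrite (lim_at_left_eq xj (@cp p^`()%R _) dwp).
rewrite (lim_at_right_eq xj (@cp p _) wp').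
rewrite (lim_at_right_eq xj (@cp p^`()%R _) dwp).
congr col_mx; apply/matrixP => i ?; rewrite !mxE.
by apply: eq_Rintegral => t /set_mem tj; rewrite wp.
Qed.

Lemma cell_rhs_local (R : realType) (x : nat -> R) (j k : nat) (P : 'M[R]_2)
    (u v : R -> R) : x j < x j.+1 ->
  (forall t, closed_cell x j t -> u t = v t) ->
  cell_rhs x j k P u = cell_rhs x j k P v.
Proof.
move=> xj uv.
have uv' t : x j <= t <= x j.+1 -> u t = v t.
  by move=> ?; apply: uv; rewrite /closed_cell/= in_itv.
rewrite /cell_rhs (eq_left_derivative xj uv').
rewrite (eq_right_derivative xj uv') !uv' ?lexx ?ltW//.
congr col_mx; apply/matrixP => i ?; rewrite !mxE.
apply: eq_Rintegral => t /set_mem tj; rewrite uv//.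
exact: subset_itv_oo_cc tj.
Qed.

Lemma cell_system_horner_linear (R : realType) (x : nat -> R) (j k : nat)
    (P : 'M[R]_2) (c : R) (p q : {poly R}) :
  let s (p : {poly R}) := cell_system x j k P (horner p)
    p.[x j] (p^`()).[x j] p.[x j.+1] (p^`()).[x j.+1] in
  s (c *: p + q) = c *: s p + s q.
Proof.
move=> s; rewrite /s /cell_system derivD derivZ !hornerD !hornerZ.
rewrite !pair_col_linear !mulmxDr -!scalemxAr !scale_col_mx !add_col_mx.
congr col_mx.
have cX (r : {poly R}) m : continuous (fun t => r.[t] * t ^+ m).
  move=> t; apply: cvgM; [exact: continuous_horner|exact: exprn_continuous].
have mj : measurable (cell x j) by exact: measurable_itv.
apply/matrixP => i ?; rewrite !mxE -RintegralZl//; last first.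
  exact: continuous_integrable_itv.
rewrite -RintegralD//; last exact: continuous_integrable_itv.
  by apply: eq_Rintegral => t _; rewrite hornerD hornerZ mulrDl mulrA.
apply: (@continuous_integrable_itv _ (fun t => c * (p.[t] * t ^+ i))) => t.
by apply: cvgM; [exact: cvg_cst|exact: cX].
Qed.

(** The monomials span the test polynomials; continuity makes the integrals linear in the test
    polynomial. *)
Lemma moments_eqP (R : realType) (f g : R -> R) (y z : R) (n : nat) :
  continuous f -> continuous g ->
  (forall v : {poly R}, (size v <= n)%N ->
     Rintegral lebesgue_measure `]y, z[ (fun t => f t * v.[t]) =
     Rintegral lebesgue_measure `]y, z[ (fun t => g t * v.[t])) <->
  forall i : 'I_n, Rintegral lebesgue_measure `]y, z[ (fun t => f t * t ^+ i) =
     Rintegral lebesgue_measure `]y, z[ (fun t => g t * t ^+ i).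
Proof.
move=> cf cg; split=> [fg i|fg v vn].
  have := fg 'X^i; rewrite size_polyXn => /(_ (ltn_ord i)).
  by under eq_Rintegral do rewrite hornerXn;
    under [in RHS]eq_Rintegral do rewrite hornerXn.
rewrite !(@Rintegral_horner _ _ _ _ _ n)//.
by apply: eq_bigr => i _; rewrite fg.
Qed.

(** * Periodic identification and the equivalence of the systems *)

Lemma mesh_lt (R : realType) (a b : R) (N : nat) (x : nat -> R) (j : 'I_N) :
  is_mesh a b N x -> x j < x j.+1.
Proof. by case=> _ _; exact. Qed.

Lemma periodic_mesh_ordS (R : realType) (a b : R) (N : nat) (x : nat -> R)
    (f : R -> R) (j : 'I_N) : is_mesh a b N x -> periodic f (b - a) ->
  f (x (ordS j)) = f (x j.+1).
Proof.
move=> [x0 xN _] fT /=.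
(* After the last cell comes cell 0, whose left end [a] is one period away from [b]. *)
have [->|] := eqVneq j.+1 N; first by rewrite modnn x0 xN -(fT a) addrC subrK.
by rewrite neq_ltn [(N < _)%N]ltnNge ltn_ord orbF => jN; rewrite modn_small.
Qed.

Theorem lemma3p1 (R : realType) (a b : R) (N : nat) (x : nat -> R) (k : nat)
    (alpha1 beta1 beta2 : R) :
  (0 < N)%N -> is_mesh a b N x -> (1 <= k)%N ->
  alpha1 ^+ 2 + beta1 * beta2 = 4^-1 ->
  local_projection a b N x k alpha1 beta1 beta2.
Proof.
move=> N0 mesh k1 /flux_mx_idem PP; set P := flux_mx _ _ _ in PP.
exists (fun=> k.-1 + (2 + 2))%N, (fun j => cell_lhs x j k P),
  (fun j => cell_rhs x j k P).
have xlt j := mesh_lt j mesh.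
split.
- move=> j c v w /(_ j)[p _ vp] /(_ j)[q _ wq].
  rewrite (cell_lhs_poly k P (xlt j) vp) (cell_lhs_poly k P (xlt j) wq).
  rewrite -cell_system_horner_linear; apply: cell_lhs_poly => // t tj.
  by rewrite hornerD hornerZ vp ?wq.
- move=> j v w _ /(_ j)[q _ wq] vw.
  rewrite (cell_lhs_poly k P (xlt j) wq).
  by apply: cell_lhs_poly => // t tj; rewrite vw// wq.
- by move=> j u u' _ _; exact: cell_rhs_local.
move=> u w [uT cu _ du] Vw.
have dr (j : 'I_N) : right_derivative u (x j) = (u^`())%classic (x j).
  by apply: right_derivativeE; exact/du/ltnW.
have dl (j : 'I_N) : left_derivative u (x j.+1) = (u^`())%classic (x j.+1).
  by apply: left_derivativeE; exact/du.
have momP (j : 'I_N) :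
  (forall v : {poly R}, (size v <= k.-1)%N ->
     Rintegral lebesgue_measure (cell x j) (fun t => w t * v.[t]) =
     Rintegral lebesgue_measure (cell x j) (fun t => u t * v.[t])) <->
  forall i : 'I_k.-1,
    Rintegral lebesgue_measure (cell x j) (fun t => w t * t ^+ i) =
    Rintegral lebesgue_measure (cell x j) (fun t => u t * t ^+ i).
  (* [w] may jump at the nodes, so it is replaced on the cell by the continuous function [p] before
     comparing moments. *)
  have [p _ wp] := Vw j.
  have eqw (h : R -> R) :
      Rintegral lebesgue_measure (cell x j) (fun t => w t * h t) =
      Rintegral lebesgue_measure (cell x j) (fun t => p.[t] * h t).
    by apply: eq_Rintegral => t /set_mem tj; rewrite wp.
  have pu := moments_eqP (x j) (x j.+1) k.-1 (@continuous_horner R p) cu.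
  by split=> [H i|H v vk]; rewrite eqw;
    [apply: pu.1 => ? ?|apply: pu.2 => // ?]; rewrite -eqw H.
(* The data in the [P] equation are moved by periodicity to the left end of cell [ordS j], so that
   each equation has exactly the form of a block of one cell's system. *)
have jumpP (j : 'I_N) :
  (average x w j - alpha1 * jump x w j
     + beta2 * jump x (w^`())%classic j = u (x j.+1) /\
   average x (w^`())%classic j + alpha1 * jump x (w^`())%classic j
     + beta1 * jump x w j = (u^`())%classic (x j.+1)) <->
  P *m pair_col (trace_plus x w j) (trace_plus x (w^`())%classic j) =
    P *m pair_col (u (x (ordS j))) (right_derivative u (x (ordS j))) /\
  (1%:M - P) *m pair_col (trace_minus x w j) (trace_minus x (w^`())%classic j) =
    (1%:M - P) *m pair_col (u (x j.+1)) (left_derivative u (x j.+1)).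
  rewrite dl dr (periodic_mesh_ordS _ mesh uT).
  rewrite (periodic_mesh_ordS _ mesh (derive1_periodic uT)).
  by rewrite -idem_split_eq// interface_eqP.
split=> [[_ H] j|H].
  have [/momP Hm Hu Hd] := H j; have [_ Hl] := (jumpP j).1 (conj Hu Hd).
  (* The left-end block of cell [j] comes from the interface it shares with its cyclic
     predecessor. *)
  have [_ Hu' Hd'] := H (ord_pred j).
  have [+ _] := (jumpP (ord_pred j)).1 (conj Hu' Hd').
  by rewrite /trace_plus ord_predK => Hr; apply/cell_system_eqP.
split=> // j.
(* Conversely, the interface after cell [j] is rebuilt from the right-end block of cell [j] and the
   left-end block of cell [ordS j]. *)
have /cell_system_eqP[Hm _ Hl] := H j.
have /cell_system_eqP[_ Hr _] := H (ordS j).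
have [Hu Hd] := (jumpP j).2 (conj Hr Hl).
by split=> //; exact/momP.
Qed.
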